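(* Let $h>0$ and let $H_1,\dots,H_m$ be closed half-planes in the $(c,d)$-plane, each given by a linear inequality $A_j\cdot(c,d)\le B_j$ (with $A_j\in\mathbb{R}^2$, $B_j\in\mathbb{R}$). Let $F$ consist of the point $(h,0)$ together with every intersection point of the circle $c^2+d^2=h^2$ with the boundary lines of the $H_j$; constant inequalities (those with $A_j=0$) contribute no boundary points. Then $|F|\le2m+1$, and the circle $c^2+d^2=h^2$ meets $\bigcap_jH_j$ if and only if some point of $F$ belongs to every $H_j$. More generally, designate some of the inequalities as mandatory and assign nonnegative deletion costs to the others. If some point of the circle satisfies all mandatory inequalities, then the minimum, over all points of the circle satisfying the mandatory inequalities, of the total cost of the violated non-mandatory inequalities is attained at a point of $F$ satisfying the mandatory inequalities.
   Context: For $A_j\neq 0$ the boundary line of $H_j$ is $\{(c,d):A_j\cdot(c,d)=B_j\}$. When $A_j=0$ the inequality is constant (either always true or always false) and $H_j$ is correspondingly the whole plane or empty. *)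

(* Defs.v *)
From HB Require Import structures.
From mathcomp Require Import all_boot all_order all_algebra.
From mathcomp Require Import all_classical all_reals.

Set Implicit Arguments.
Unset Strict Implicit.
Unset Printing Implicit Defensive.

Import Order.TTheory GRing.Theory Num.Theory.

Local Open Scope classical_set_scope.
Local Open Scope ring_scope.

Section HalfPlanes.
Variable R : realType.
Implicit Types (a p : R * R) (b h : R) (m : nat).

Definition dot a p : R := a.1 * p.1 + a.2 * p.2.

Definition circle h : set (R * R) := [set p | p.1 ^+ 2 + p.2 ^+ 2 = h ^+ 2].

(* For a = 0 this is the whole plane or empty, according to the sign of b. *)
Definition half_plane a b : set (R * R) := [set p | dot a p <= b].

(* A line only when a != 0; for a = b = 0 it is the whole plane, which is why
   [candidates] ranges over the nonzero normals only. *)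
Definition boundary_line a b : set (R * R) := [set p | dot a p = b].

Definition candidates h m (A : 'I_m -> R * R) (B : 'I_m -> R) : set (R * R) :=
  [set (h, 0)] `|`
  \bigcup_(j in [set j | A j != 0]) (circle h `&` boundary_line (A j) (B j)).

Definition feasible h m (A : 'I_m -> R * R) (B : 'I_m -> R) (M : {set 'I_m}) :
    set (R * R) :=
  circle h `&` \bigcap_(j in [set` M]) half_plane (A j) (B j).

Definition deletion_cost m (A : 'I_m -> R * R) (B : 'I_m -> R) (M : {set 'I_m})
    (w : 'I_m -> R) (p : R * R) : R :=
  \sum_(j < m | (j \notin M) && (p \notin half_plane (A j) (B j))) w j.

End HalfPlanes.

(* Main.v *)
(** Stereographic projection from [(h, 0)] turns the rest of the circle into a
    line with parameter [t], and each half-plane into a quadratic inequality in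
    [t].  Starting from any point of the circle, increase [t]: either no
    inequality satisfied at the start ever fails, and then all of them hold at
    the limit point [(h, 0)], or the first one about to fail does so on its
    boundary line.  In both cases a candidate point is reached which satisfies
    every inequality that the starting point satisfies. *)
Require Import Defs.
From HB Require Import structures.
From mathcomp Require Import all_boot all_order all_algebra.
From mathcomp Require Import all_classical all_reals.
From mathcomp Require Import ring lra.

Set Implicit Arguments.
Unset Strict Implicit.
Unset Printing Implicit Defensive.

Import Order.TTheory GRing.Theory Num.Theory.

Local Open Scope classical_set_scope.
Local Open Scope ring_scope.

(** For [a > 0] the exit is the larger root, real and nonnegative because [c <= 0]. For [a <= 0] an
    exit is taken only if [b > 0] and the discriminant is nonnegative; it is then the smaller root.
    The sign [a <= 0] kept in the first alternative controls the limit as [u] grows. *)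
Lemma quadratic_stays_or_exits (R : rcfType) (a b c : R) : c <= 0 ->
  (a <= 0 /\ forall u, 0 <= u -> a * u ^+ 2 + b * u + c <= 0) \/
  exists r, [/\ 0 <= r, a * r ^+ 2 + b * r + c = 0 &
    forall u, 0 <= u <= r -> a * u ^+ 2 + b * u + c <= 0].
Proof.
move=> c_le0; set D := b ^+ 2 - 4 * a * c.
have s_ge0 := sqrtr_ge0 D; set s := Num.sqrt D in s_ge0 *.
have [a_le0|a_gt0] := leP a 0; last first.
  have sE : s ^+ 2 = D by rewrite sqr_sqrtr // /D; nra.
  have b_le_s : `|b| <= s by rewrite -sqrtr_sqr ler_wsqrtr // /D; nra.
  have [b_le Nb_le] : b <= s /\ - s <= b.
    by move: b_le_s; rewrite ler_norml => /andP[].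
  right; exists ((s - b) / (2 * a)); split.
  - by apply: divr_ge0; lra.
  - have -> : c = (b ^+ 2 - s ^+ 2) / (4 * a) by rewrite sE /D; field; lra.
    by field; lra.
  - move=> u; rewrite ler_pdivlMr; last lra.
    move=> /andP[u_ge0 u_le]; rewrite -(pmulr_rle0 _ a_gt0).
    (* This product is [s ^+ 2 - (2 * a * u + b) ^+ 2], that is, [- 4 * a] times the quadratic. *)
    have : 0 <= (s - (2 * a * u + b)) * (s + (2 * a * u + b)).
      by apply: mulr_ge0; nra.
    by rewrite /D in sE; lra.
have [b_le0|b_gt0] := leP b 0; first by left; split=> // u u_ge0; nra.
have [D_lt0|D_ge0] := ltP D 0.
  left; split=> // u u_ge0; rewrite /D in D_lt0.
  have a_lt0 : a < 0.
    by rewrite lt_neqAle a_le0 andbT; apply/eqP => a0; rewrite a0 in D_lt0; nra.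
  rewrite -(nmulr_rge0 _ a_lt0); have := sqr_ge0 (2 * a * u + b); lra.
have sE : s ^+ 2 = D by rewrite sqr_sqrtr.
(* The rationalized root formula also covers [a = 0]. *)
pose r := - (2 * c) / (b + s).
have bs_gt0 : 0 < b + s by lra.
have bs_r : (b + s) * r = - (2 * c) by rewrite /r; field; lra.
have ar : 2 * a * r + b = s.
  apply: (mulfI (lt0r_neq0 bs_gt0)); rewrite mulrDr mulrCA bs_r.
  by rewrite /D in sE; lra.
have fr : a * r ^+ 2 + b * r + c = 0 by nra.
right; exists r; split=> //; first by apply: divr_ge0; lra.
move=> u /andP[u_ge0 u_le].
have -> : a * u ^+ 2 + b * u + c = (u - r) * (a * (u + r) + b).
  by rewrite -[LHS]subr0 -fr; ring.
(* As [a <= 0] and [u <= r], the second factor is at least [2 * a * r + b = s]. *)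
by apply: mulr_le0_ge0; nra.
Qed.

Section Circle.
Variables (R : realType) (h : R).
Implicit Types (a p q : R * R) (b t : R).

Definition stereo t : R * R :=
  (h * (t ^+ 2 - 1) / (t ^+ 2 + 1), h * (2 * t) / (t ^+ 2 + 1)).

Let sqrD1_gt0 t : 0 < t ^+ 2 + 1.
Proof. by rewrite ltr_wpDl // sqr_ge0. Qed.

Lemma stereo_circle t : circle h (stereo t).
Proof. by rewrite /circle /=; field; rewrite gt_eqF. Qed.

Lemma stereo_onto q : circle h q -> q != (h, 0) -> exists t, q = stereo t.
Proof.
case: q => x y; rewrite /circle /= => xyE xy_neq.
have hx_neq0 : h - x != 0.
  apply: contraNneq xy_neq => /eqP; rewrite subr_eq0 => /eqP hx.
  move: xyE; rewrite -hx -[RHS]addr0 => /addrI /eqP.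
  by rewrite expf_eq0 /= => /eqP ->.
(* Minus the slope of the line through [(h, 0)] and [q]. *)
exists (y / (h - x)); rewrite /stereo.
have y2 : y ^+ 2 = (h - x) * (h + x) by rewrite -subr_sqr -xyE; ring.
have t2 : (y / (h - x)) ^+ 2 = (h + x) / (h - x).
  by rewrite expr_div_n y2; field.
have h_neq0 : h != 0.
  apply: contraNneq hx_neq0 => h0; move/eqP: xyE.
  rewrite h0 expr0n /= paddr_eq0 ?sqr_ge0 // expf_eq0 /= => /andP[/eqP -> _].
  by rewrite subr0.
rewrite t2; congr pair; field; rewrite ?hx_neq0 /=.
all: by have -> : h + x + (h - x) = 2 * h by [ring]; rewrite mulf_neq0 ?pnatr_eq0.
Qed.

Let dot_stereo a b t :
  dot a (stereo t) - b =
  ((h * a.1 - b) * t ^+ 2 + 2 * h * a.2 * t - (h * a.1 + b)) / (t ^+ 2 + 1).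
Proof. by rewrite /dot /=; field; rewrite gt_eqF. Qed.

Lemma half_plane_stereo a b t :
  half_plane a b (stereo t) <->
  (h * a.1 - b) * t ^+ 2 + 2 * h * a.2 * t - (h * a.1 + b) <= 0.
Proof.
by rewrite /half_plane /= -subr_le0 dot_stereo pmulr_lle0 // invr_gt0.
Qed.

Lemma boundary_line_stereo a b t :
  (h * a.1 - b) * t ^+ 2 + 2 * h * a.2 * t - (h * a.1 + b) = 0 ->
  boundary_line a b (stereo t).
Proof.
by move=> e; apply/eqP; rewrite -subr_eq0 dot_stereo e mul0r.
Qed.

(** For [a != 0], expand the quadratic around [t0] and apply the dichotomy to [u = t - t0]. The
    leading coefficient [h * a.1 - b] is nonpositive exactly when [(h, 0)] lies in the
    half-plane. *)
Lemma half_plane_stays_or_exits a b t0 : half_plane a b (stereo t0) ->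
  (half_plane a b (h, 0) /\ forall t, t0 <= t -> half_plane a b (stereo t)) \/
  exists r, [/\ a != 0, t0 <= r, boundary_line a b (stereo r) &
    forall t, t0 <= t <= r -> half_plane a b (stereo t)].
Proof.
have [->|a_neq0] := eqVneq a 0.
  by rewrite /half_plane /dot /= !mul0r => b_ge0; left; split=> // t _;
    rewrite !mul0r.
move=> /(iffLR (half_plane_stereo _ _ _)) t0_in.
pose al := h * a.1 - b; pose be := 2 * h * a.2.
have shift t : al * t ^+ 2 + be * t - (h * a.1 + b) =
    al * (t - t0) ^+ 2 + (2 * al * t0 + be) * (t - t0) +
    (al * t0 ^+ 2 + be * t0 - (h * a.1 + b)) by ring.
have [[al_le0 stays]|[r [r_ge0 fr exits]]] :=
  quadratic_stays_or_exits al (2 * al * t0 + be) t0_in.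
- left; split; first by rewrite /half_plane /dot /=; rewrite /al in al_le0; lra.
  by move=> t t_ge; apply/(iffRL (half_plane_stereo _ _ _)); rewrite shift stays ?subr_ge0.
- right; exists (t0 + r); split=> //; first by rewrite lerDl.
    by apply: boundary_line_stereo; rewrite shift (addrC t0) addrK.
  move=> t /andP[t_ge t_le]; apply/(iffRL (half_plane_stereo _ _ _)).
  by rewrite shift exits // subr_ge0 t_ge lerBlDl.
Qed.

Variables (m : nat) (A : 'I_m -> R * R) (B : 'I_m -> R).

(** Passing from [q] to [p] can only shrink the set of violated inequalities, which serves both
    feasibility and cost minimization. *)
Lemma candidate_dominates q : circle h q ->
  exists2 p, candidates h A B p &
    forall j, half_plane (A j) (B j) q -> half_plane (A j) (B j) p.
Proof.
move=> q_circle; have [->|q_neq] := eqVneq q (h, 0).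
  by exists (h, 0) => //; left.
have [t0 ->{q_circle q_neq}] := stereo_onto q_circle q_neq.
pose S := [pred j | `[< half_plane (A j) (B j) (stereo t0) >]].
(* [None] stands for an inequality that never fails after [t0]. *)
have /choice[e eP] : forall j, exists e : option R, S j ->
    if e is Some r then
      [/\ A j != 0, t0 <= r, boundary_line (A j) (B j) (stereo r) &
        forall t, t0 <= t <= r -> half_plane (A j) (B j) (stereo t)]
    else half_plane (A j) (B j) (h, 0) /\
      forall t, t0 <= t -> half_plane (A j) (B j) (stereo t).
  move=> j; have [Sj|nSj] := boolP (S j); last by exists None.
  have [stays|[r rP]] := half_plane_stays_or_exits (asboolW Sj).
    by exists None.
  by exists (Some r).
have [/existsP[i0 Pi0]|/existsPn noexit] := boolP [exists j, S j && isSome (e j)].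
(* Stop at the earliest exit. The default [0] is never compared, since only indices with an exit are
   considered. *)
- case: (@arg_minP _ _ _ i0 [pred j | S j && e j] (fun j => odflt 0 (e j)) Pi0) => i /andP[Si].
  move: (eP i Si); case: (e i) => //= r [Ai_neq0 t0_le r_line _] _ r_min.
  exists (stereo r).
    by right; exists i => //; split=> //; exact: stereo_circle.
  move=> j /asboolP Sj; move: (eP j Sj) (r_min j); rewrite /= (Sj : `[< _ >] = true) /=.
  case: (e j) => [r'|] /= [].
    by move=> _ _ _ exits /(_ isT) r_le; apply: exits; rewrite t0_le.
  by move=> _ stays _; exact: stays.
- exists (h, 0); first by left.
  move=> j /asboolP Sj; move: (noexit j) (eP j Sj); rewrite (Sj : S j = true) /=.
  by case: (e j) => // _ [].
Qed.

Lemma candidates_circle : candidates h A B `<=` circle h.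
Proof. by move=> p [->|[j _ []]//]; rewrite /circle /= expr0n addr0. Qed.

(* A point is determined by its scalar product [b] and its cross product [x]
   with [a != 0]; on the circle, [x ^+ 2 = |a| ^+ 2 * h ^+ 2 - b ^+ 2]. *)
Definition chord_end a b (i : bool) : R * R :=
  let n := a.1 ^+ 2 + a.2 ^+ 2 in
  let x := (-1) ^+ i * Num.sqrt (n * h ^+ 2 - b ^+ 2) in
  ((a.1 * b - a.2 * x) / n, (a.2 * b + a.1 * x) / n).

Lemma circle_boundary_line a b p : a != 0 ->
  circle h p -> boundary_line a b p -> exists i, p = chord_end a b i.
Proof.
case: a p => a1 a2 [p1 p2] a_neq0; rewrite /circle /boundary_line /dot /=.
move=> pE bE; pose n := a1 ^+ 2 + a2 ^+ 2; pose x := a1 * p2 - a2 * p1.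
have n_neq0 : n != 0.
  apply: contraNneq a_neq0 => /eqP; rewrite paddr_eq0 ?sqr_ge0 //.
  by rewrite !expf_eq0 /= => /andP[/eqP -> /eqP ->].
have x2 : n * h ^+ 2 - b ^+ 2 = x ^+ 2 by rewrite -pE -bE /n /x; ring.
(* The boolean records the sign of the cross product: [(-1) ^+ (x < 0) * |x| = x]. *)
exists (x < 0); rewrite /chord_end /= -/n x2 sqrtr_sqr -numEsign.
by rewrite -bE /x; congr pair; rewrite /n in n_neq0 *; field.
Qed.

(** All candidates occur in a list made of [(h, 0)] and two chord ends per index. Repetitions, and
    spurious entries from zero normals or lines missing the circle, do not affect the upper
    bound. *)
Lemma card_candidates : (candidates h A B #<= `I_(2 * m + 1))%card.
Proof.
pose s := [seq chord_end (A j) (B j) i | j <- enum 'I_m, i <- [:: true; false]].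
have -> : (2 * m + 1)%N = size ((h, 0) :: s).
  by rewrite /= /s size_allpairs size_enum_ord mulnC addn1.
apply: card_le_trans (card_image_le (nth (h, 0) ((h, 0) :: s)) _).
apply: subset_card_le => p p_cand.
have /(nthP (h, 0))[k k_lt <-] : p \in (h, 0) :: s; last by exists k.
case: p_cand => [->|[j Aj_neq0 [p_circle p_line]]]; first exact: mem_head.
have [i ->] := circle_boundary_line Aj_neq0 p_circle p_line.
rewrite inE; apply/orP; right; apply/allpairsP; exists (j, i).
by split; rewrite ?mem_enum //; case: (i).
Qed.

(** Replace a feasible minimizer [q] by a candidate dominating it: mandatory inequalities remain
    satisfied, and with nonnegative weights the cost cannot increase. *)
Lemma deletion_cost_minimizer (M : {set 'I_m}) (w : 'I_m -> R) :
  (forall j, j \notin M -> 0 <= w j) ->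
  feasible h A B M !=set0 ->
  exists2 p, (candidates h A B `&` feasible h A B M) p &
    forall q, feasible h A B M q ->
      deletion_cost A B M w p <= deletion_cost A B M w q.
Proof.
move=> w_ge0 [q0 q0_feas].
(* The cost of a point depends only on the finite set of inequalities it
   violates, so a minimum exists. *)
pose viol q := [set j | q \notin half_plane (A j) (B j)]%SET.
pose cost (V : {set 'I_m}) := \sum_(j < m | (j \notin M) && (j \in V)) w j.
have costE q : deletion_cost A B M w q = cost (viol q).
  by apply: eq_bigl => j; rewrite inE.
pose realised V := `[< exists2 q, feasible h A B M q & viol q = V >].
have real0 : realised (viol q0) by apply/asboolP; exists q0.
case: (@arg_minP _ _ _ (viol q0) realised cost real0) => V /asboolP[q q_feas <-] q_min.
have [q_circle q_mand] := q_feas.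
have [p p_cand p_dom] := candidate_dominates q_circle.
exists p.
  split=> //; split; first exact: candidates_circle.
  by move=> j Mj; apply: p_dom; exact: q_mand.
move=> q' q'_feas; apply: le_trans (_ : deletion_cost A B M w q <= _).
  rewrite /deletion_cost big_mkcond [leRHS]big_mkcond; apply: ler_sum => j _.
  have [//|jM] /= := boolP (j \in M).
  case: (boolP (p \in _)) => /= [_|p_out]; first by case: ifP => // _; exact: w_ge0.
  have -> // : q \notin half_plane (A j) (B j).
  by apply: contra p_out; rewrite !inE; exact: p_dom.
by rewrite !costE; apply: q_min; apply/asboolP; exists q'.
Qed.

End Circle.

Theorem proposition3p2 (R : realType) (h : R) (h_gt0 : 0 < h) (m : nat)
    (A : 'I_m -> R * R) (B : 'I_m -> R) :
  [/\ (candidates h A B #<= `I_(2 * m + 1))%card,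
      (circle h `&` \bigcap_j half_plane (A j) (B j)) !=set0 <->
      (exists2 p, candidates h A B p & forall j, half_plane (A j) (B j) p)
    & forall (M : {set 'I_m}) (w : 'I_m -> R),
        (forall j, j \notin M -> 0 <= w j) ->
        feasible h A B M !=set0 ->
        exists2 p, (candidates h A B `&` feasible h A B M) p &
          forall q, feasible h A B M q ->
            deletion_cost A B M w p <= deletion_cost A B M w q].
Proof.
split; [exact: card_candidates | split | exact: deletion_cost_minimizer].
- move=> [q [q_circle q_in]]; have [p p_cand p_dom] := candidate_dominates A B q_circle.
  by exists p => // j; apply: p_dom; exact: q_in.
- move=> [p p_cand p_in]; exists p; split=> [|j _]; last exact: p_in.
  exact: candidates_circle p_cand.
Qed.
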